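(* Let $X$ be a continuous random variable with cdf $F_X$, pdf $f_X$ and support $S_X$. The following two statements are equivalent for any $F_X\in\mathbb{C}$: (i) the random variable $X$ has a symmetric distribution; (ii) $\bar{\xi}J(X)=\xi J(X)$.
   Context: $F_X^{-1}$ denotes the inverse function of $F_X$, and $\bar F_X=1-F_X$. Symmetric: $X$ has a symmetric distribution if there is a finite real number $c$ such that $f_X(c+x)=f_X(c-x)$, that is, $F_X(c-x)+F_X(c+x)=1$, for all real $x$. Class $\mathbb{C}$: the class of all continuous pdfs $f_X$, with cdf $F_X$, such that either $f_X(F_X^{-1}(1-u))\ge f_X(F_X^{-1}(u))$ for all $u\in(0,\tfrac12)$, or $f_X(F_X^{-1}(1-u))\le f_X(F_X^{-1}(u))$ for all $u\in(0,\tfrac12)$; $F_X\in\mathbb{C}$ means that the distribution with cdf $F_X$ belongs to this class. Cumulative residual extropy: $\xi J(X)=-\frac12\int_{S_X}\bar F_X^2(x)\,dx=-\frac12\int_0^1\frac{u^2}{f_X(F_X^{-1}(1-u))}\,du$. Cumulative past extropy: $\bar\xi J(X)=-\frac12\int_{S_X}F_X^2(x)\,dx=-\frac12\int_0^1\frac{u^2}{f_X(F_X^{-1}(u))}\,du$.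
   Formalization: F_X is taken injective on {0<F_X<1} and f_X>0 almost everywhere on S_X, so that F_X^{-1} exists and both extropy formulas agree; (ii) implies (i) is claimed only if an extropy is finite, since both are -∞ for the asymmetric Gumbel law in class C. *)

(* Defs.v *)
From HB Require Import structures.
From mathcomp Require Import all_boot all_order all_algebra.
From mathcomp Require Import all_classical all_reals all_analysis.
Import Order.TTheory GRing.Theory Num.Theory.
Import numFieldNormedType.Exports.
Set Implicit Arguments.
Unset Strict Implicit.
Unset Printing Implicit Defensive.

Local Open Scope classical_set_scope.
Local Open Scope ring_scope.

Section Extropy.
Context {d : measure_display} {T : measurableType d} {R : realType}.
Context {P : probability T R}.
Implicit Types (X : {RV P >-> R}) (f : R -> R).

Definition is_pdf X f : Prop :=
  [/\ measurable_fun setT f,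
      forall x, 0 <= f x
    & forall A : set R, measurable A ->
        distribution P X A = (\int[lebesgue_measure]_(x in A) (f x)%:E)%E].

(* The library's [cdf] is extended-real-valued. *)
Definition rcdf X (x : R) : R := fine (cdf X x).

(* Topological support of the law of [X]; unlike [set x | 0 < f x], it does
   not depend on the choice of the density. *)
Definition supp X : set R :=
  [set x | forall e : R, 0 < e -> (0 < distribution P X (ball x e))%E].

Definition cdf_domain X : set R := [set x | 0 < rcdf X x < 1].

Definition cdf_invertible X : Prop := {in cdf_domain X &, injective (rcdf X)}.

(* When [cdf_invertible X] holds and [rcdf X] is continuous, this is a
   two-sided inverse of [rcdf X] between [cdf_domain X] and the open unit
   interval; elsewhere its value is irrelevant. *)
Definition cdf_inv X : R -> R := pinv (cdf_domain X) (rcdf X).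

Definition symmetric_distribution X : Prop :=
  exists c : R, forall x : R, rcdf X (c - x) + rcdf X (c + x) = 1.

(* Continuity is only required inside the support, so that densities with a
   jump at an endpoint (uniform, exponential) are not excluded. *)
Definition classC X f : Prop :=
  (forall x, interior (supp X) x -> {for x, continuous f}) /\
  ((forall u : R, 0 < u < 2^-1 ->
      f (cdf_inv X (1 - u)) >= f (cdf_inv X u)) \/
   (forall u : R, 0 < u < 2^-1 ->
      f (cdf_inv X (1 - u)) <= f (cdf_inv X u))).

(* Both extropies take the value -oo when the integral diverges. *)
Definition cumulative_residual_extropy X : \bar R :=
  (- (2^-1)%:E *
    \int[lebesgue_measure]_(x in supp X) ((1 - rcdf X x) ^+ 2)%:E)%E.

Definition cumulative_past_extropy X : \bar R :=
  (- (2^-1)%:E *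
    \int[lebesgue_measure]_(x in supp X) ((rcdf X x) ^+ 2)%:E)%E.

End Extropy.

(* Main.v *)
Require Import Defs.
From HB Require Import structures.
From mathcomp Require Import all_boot all_order all_algebra.
From mathcomp Require Import all_classical all_reals all_analysis.
From mathcomp Require Import measurable_realfun ring lra.
Import Order.TTheory GRing.Theory Num.Theory.
Import numFieldNormedType.Exports.

Set Implicit Arguments.
Unset Strict Implicit.

Local Open Scope classical_set_scope.
Local Open Scope ring_scope.

(** Let F be the cdf of X, D = {0 < F < 1}, Q the inverse of F on D, mu the law
    of X and lambda Lebesgue measure. The support of mu is D up to at most two
    points, so both extropies are integrals over D.

    If X is symmetric about c, the reflection x |-> 2c - x preserves lambda and
    D and exchanges F with 1 - F; hence the extropies agree
    ([symmetric_integral]).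

    For the converse, compare this reflection with the involution
    sigma(x) = Q(1 - F(x)) of D, which always exchanges F with 1 - F. Because
    F(X) is uniform, sigma preserves mu ([law_reflect]). It preserves lambda
    only in the symmetric case, and the defect is measured by the reciprocal
    density g = 1/f: since f > 0 almost everywhere on D, lambda restricted to D
    is g mu, and its image by sigma is (g o sigma) mu
    ([integral_lebesgue_law], [integral_lebesgue_reflect]).

    If the extropies are finite and equal then 1 - 2F, the difference of
    (1 - F)^2 and F^2, has integral 0 on D, that is, the integrals of |1 - 2F|
    below and above the median coincide ([tail_weight_balance]). Written below
    the median with respect to mu, this says that |1 - 2F| g and
    |1 - 2F| (g o sigma) have the same integral. Membership in the class C makes
    g and g o sigma comparable there, almost everywhere; as |1 - 2F| > 0 below
    the median, g = g o sigma almost everywhere ([inv_density_reflect]). Thus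
    sigma preserves lambda after all: the intervals from x to the median m and
    from m to sigma(x) have the same length, so sigma(x) = 2m - x
    ([reflect_lower]), and X is symmetric about m ([symmetric_of_reflect]). *)

(** * The cdf of a law without atoms *)

Section Law.
Context {R : realType} {d : measure_display} {T : measurableType d}
  {P : probability T R} (X : {RV P >-> R}).
Local Notation mu := (distribution P X).
Local Notation F := (rcdf X).
Local Notation D := (cdf_domain X).

Lemma rcdfE x : (F x)%:E = mu `]-oo, x].
Proof. by rewrite /rcdf fineK// fin_num_measure. Qed.

Lemma rcdf_ge0 x : 0 <= F x.
Proof. by rewrite -lee_fin rcdfE. Qed.

Lemma rcdf_le1 x : F x <= 1.
Proof. by rewrite -lee_fin rcdfE; exact: probability_le1. Qed.

Lemma le_rcdf x y : x <= y -> F x <= F y.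
Proof.
by move=> xy; rewrite -lee_fin !rcdfE le_measure ?inE//; exact: subitvPr.
Qed.

Lemma measurable_rcdf : measurable_fun setT F.
Proof.
by apply: nondecreasing_measurable => //; move=> x y; exact: le_rcdf.
Qed.

Lemma measurable_cdf_domain : measurable D.
Proof.
rewrite (_ : D = F @^-1` `]0, 1[)%classic.
  by rewrite -[X in measurable X]setTI; exact: measurable_rcdf.
by apply/seteqP; split => x; rewrite /cdf_domain/= in_itv.
Qed.

Lemma law_itv x y : x <= y -> mu `]x, y] = (F y - F x)%:E.
Proof.
move=> xy; rewrite EFinB !rcdfE.
have -> : `]x, y]%classic = `]-oo, y] `\` `]-oo, x].
  apply/seteqP; split => z /=; rewrite !in_itv/=.
    by move=> /andP[xz ->]; split => //; apply/negP; rewrite -ltNge.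
  by move=> [-> /negP]; rewrite -ltNge => ->.
rewrite measureD//; last by rewrite ltey_eq fin_num_measure.
by rewrite setIidr//; exact: subitvPr.
Qed.

Section Diffuse.
Hypothesis mu_set1 : forall x, mu [set x] = 0%E.

Lemma law_ray x : mu `[x, +oo[ = (1 - F x)%:E.
Proof.
rewrite -setCitvl probability_setC// EFinB rcdfE; congr (_ - _)%E.
by rewrite -(@setUitv1 _ _ -oo%O x true)// (measureU0 _ _ (mu_set1 x)).
Qed.

Lemma law_lt x : mu `]-oo, x[ = (F x)%:E.
Proof.
by rewrite rcdfE -(@setUitv1 _ _ -oo%O x true)// (measureU0 _ _ (mu_set1 x)).
Qed.

(** A cdf is right continuous; in the absence of atoms it is also left
    continuous, because F(y) = 1 - G(-y) where G is the cdf of -X. *)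
Lemma rcdf_continuous : continuous F.
Proof.
have rc (Y : {RV P >-> R}) : right_continuous (rcdf Y).
  move=> x; have := @cdf_right_continuous _ _ _ _ Y x.
  by rewrite -[cdf Y x]fineK ?fin_num_measure// => /fine_cvgP[].
pose Y : {RV P >-> R} := \- X.
have FE y : F y = 1 - rcdf Y (- y).
  apply: EFin_inj; rewrite -law_lt EFinB.
  rewrite -[rcdf Y _]/(fine (cdf Y (- y))) fineK ?fin_num_measure//.
  have -> : cdf Y (- y) = mu (~` `]-oo, y[).
    rewrite /cdf /distribution /pushforward; congr (P _).
    apply/seteqP; split => t /=; rewrite !in_itv/= lerN2.
      by move=> h; apply/negP; rewrite -leNgt.
    by move/negP; rewrite -leNgt.
  rewrite probability_setC//; symmetry.
  rewrite (_ : _ `]-oo, y[%classic = (F y)%:E); last exact: law_lt.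
  by rewrite law_lt -!EFinB; congr EFin; rewrite subKr.
move=> x; apply/left_right_continuousP; split; last exact: rc.
apply/cvg_at_leftNP.
rewrite [X in X @ _](_ : _ = (fun y => 1 - rcdf Y y)); last first.
  by apply/funext => y /=; rewrite FE opprK.
by rewrite FE; apply: cvgB; [exact: cvg_cst|exact: rc].
Qed.

Lemma rcdf_onto (u : R) : 0 < u < 1 -> exists x, F x = u.
Proof.
move=> /andP[u0 u1].
have [a Fa] : exists a, F a < u.
  have : \forall x \near -oo, (cdf X x < u%:E)%E.
    have /open_ereal_lt' : (0 < u%:E)%E by rewrite lte_fin.
    exact: cvg_cdfNy0.
  by move/filter_ex => [a]; exists a; rewrite -lte_fin rcdfE.
have [b Fb] : exists b, u < F b.
  have : \forall x \near +oo, (u%:E < cdf X x)%E.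
    have /open_ereal_gt' : (u%:E < 1)%E by rewrite lte_fin.
    exact: cvg_cdfy1.
  by move/filter_ex => [b]; exists b; rewrite -lte_fin rcdfE.
have ab : a <= b.
  by rewrite leNgt; apply/negP => /ltW/le_rcdf; rewrite leNgt (lt_trans Fa Fb).
have [||c _ <-] := @IVT R F a b u ab; last by exists c.
  exact/continuous_subspaceT/rcdf_continuous.
by rewrite ge_min le_max (ltW Fa) (ltW Fb) orbT.
Qed.

End Diffuse.
End Law.

(** * The reflection of the law in its quantiles *)

Section Reflection.
Context {R : realType} {d : measure_display} {T : measurableType d}
  {P : probability T R} (X : {RV P >-> R}).
Local Notation mu := (distribution P X).
Local Notation F := (rcdf X).
Local Notation D := (cdf_domain X).
Hypothesis mu_set1 : forall x, mu [set x] = 0%E.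
Hypothesis Finj : cdf_invertible X.

Lemma cdf_invK (u : R) : 0 < u < 1 -> F (cdf_inv X u) = u.
Proof.
move=> u01; have [x Fx] := rcdf_onto mu_set1 u01.
by rewrite pinvK// inE; exists x => //; rewrite /cdf_domain/= Fx.
Qed.

Lemma rcdfK : {in D, cancel F (cdf_inv X)}.
Proof. exact: pinvKV. Qed.

Lemma lt_rcdf x y : D x \/ D y -> x < y -> F x < F y.
Proof.
move=> Dxy xy; rewrite lt_neqAle (le_rcdf X (ltW xy)) andbT.
apply/eqP => Fxy; have [Dx Dy] : D x /\ D y.
  by move: Dxy; rewrite /cdf_domain/= Fxy => -[].
by move: xy; rewrite (Finj _ _ Fxy) ?inE// ltxx.
Qed.

Lemma ler_rcdfr x y : D y -> (F x <= F y) = (x <= y).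
Proof.
move=> Dy; apply/idP/idP; last exact: le_rcdf.
by apply: contraTT; rewrite -!ltNge; apply: lt_rcdf; left.
Qed.

Lemma ler_rcdfl x y : D x -> (F x <= F y) = (x <= y).
Proof.
move=> Dx; apply/idP/idP; last exact: le_rcdf.
by apply: contraTT; rewrite -!ltNge; apply: lt_rcdf; right.
Qed.

Lemma measurable_rcdf_le u : measurable [set x | F x <= u].
Proof.
rewrite (_ : [set x | _] = F @^-1` `]-oo, u]).
  by rewrite -[X in measurable X]setTI; exact: (measurable_rcdf X).
by apply/seteqP; split => x; rewrite /= in_itv.
Qed.

(** The probability integral transform. For 0 < u < 1 the event is a ray that
    ends at the quantile of u; the case u = 0 follows by monotonicity. *)
Lemma rcdf_uniform u : 0 <= u <= 1 -> mu [set x | F x <= u] = u%:E.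
Proof.
have mid v : 0 < v < 1 -> mu [set x | F x <= v] = v%:E.
  move=> v01; rewrite -{2}(cdf_invK v01) rcdfE; congr (mu _).
  have Dv : D (cdf_inv X v) by rewrite /cdf_domain/= cdf_invK.
  by apply/seteqP; split => x /=; rewrite in_itv/= -(ler_rcdfr _ Dv) cdf_invK.
rewrite !le_eqVlt => /andP[/predU1P[<- _|u0 /predU1P[->|u1]]]; last first.
- by apply: mid; rewrite u0.
- by rewrite (_ : [set x | _] = setT) ?probability_setT//; apply/seteqP;
    split => // x _; exact: rcdf_le1.
apply/eqP; rewrite eq_le measure_ge0 andbT.
apply/lee_addgt0Pr => e e0; rewrite add0e.
have [e1|e1] := ltP e 1.
  rewrite -mid ?e0// le_measure ?inE//; try exact: measurable_rcdf_le.
  by move=> x /= /le_trans; apply; exact: ltW.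
by rewrite (le_trans (probability_le1 _ _))//; exact: measurable_rcdf_le.
Qed.

(** The identity outside the domain makes this an involution of the whole line,
    measurable everywhere; the law does not charge that complement. *)
Definition cdf_reflect x := if 0 < F x < 1 then cdf_inv X (1 - F x) else x.
Local Notation sigma := cdf_reflect.

Lemma itv01_onem (u : R) : (0 < 1 - u < 1) = (0 < u < 1).
Proof. by rewrite subr_gt0 ltrBlDl -ltrBlDr subrr andbC. Qed.

Lemma rcdf_reflect x : D x -> F (sigma x) = 1 - F x.
Proof. by move=> Dx; rewrite /sigma ifT// cdf_invK// itv01_onem. Qed.

Lemma cdf_domain_reflect x : D (sigma x) <-> D x.
Proof.
rewrite /cdf_domain/= /sigma; case: ifPn => Dx; last by rewrite (negbTE Dx).
by split => // _; rewrite cdf_invK itv01_onem.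
Qed.

Lemma cdf_reflectK : involutive sigma.
Proof.
move=> x; case: (boolP (0 < F x < 1)) => Dx; last by rewrite /sigma !ifN.
apply: Finj; rewrite ?inE.
- by apply/cdf_domain_reflect/cdf_domain_reflect.
- exact: Dx.
- by rewrite !rcdf_reflect ?subKr//; apply/cdf_domain_reflect.
Qed.

Lemma ltr_cdf_reflect x y : D x -> D y -> (sigma x < sigma y) = (y < x).
Proof.
move=> Dx Dy; rewrite !ltNge -ler_rcdfr; last exact/cdf_domain_reflect.
by rewrite !rcdf_reflect// lerD2l lerN2 ler_rcdfr.
Qed.

Lemma le_cdf_reflect r x : D x -> (r <= sigma x) = (F x <= 1 - F r).
Proof.
move=> Dx; rewrite -ler_rcdfr; last exact/cdf_domain_reflect.
by rewrite rcdf_reflect// lerBrDl lerBrDr addrC.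
Qed.

(** Preimages of closed upper rays are described by F alone: this gives both the
    measurability of the reflection and its effect on the law. *)
Lemma cdf_reflect_ray r : sigma @^-1` `[r, +oo[ =
  ([set x | F x <= 1 - F r] `&` D) `|` (`[r, +oo[ `\` D).
Proof.
apply/seteqP; split=> [x|x [[/= Fx Dx]|[]]] /=.
- rewrite in_itv/= andbT => rx; have [Dx|Dx] := pselect (D x).
    by left; split => //; rewrite -le_cdf_reflect.
  right; rewrite in_itv/= andbT; split => //.
  by move: rx; rewrite /sigma ifN//; exact/negP.
- by rewrite in_itv/= le_cdf_reflect// Fx.
- by move=> + Dx; rewrite !in_itv/= /sigma ifN//; exact/negP.
Qed.

Lemma measurable_cdf_reflect : measurable_fun setT (sigma : R -> R).
Proof.
have mD := measurable_cdf_domain X.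
apply: (measurability (@RGenCInfty.G R)) => [|/= _ [_] [r] -> <-].
  exact: RGenCInfty.measurableE.
rewrite setTI cdf_reflect_ray; apply: measurableU.
  by apply: measurableI => //; exact: measurable_rcdf_le.
exact: measurableD.
Qed.

Lemma law_cdf_domainC : mu (~` D) = 0%E.
Proof.
have mD := measurable_cdf_domain X.
suff mu_D : mu D = 1%E by rewrite probability_setC//= (_ : _ D = 1%E) ?subee.
apply/eqP; rewrite eq_le probability_le1//=; apply/lee_addgt0Pr => e e0.
have [e1|e1] := ltP e 1; last first.
  by apply: (@le_trans _ _ e%:E); rewrite ?lee_fin// leeDr.
have : (mu ([set x | F x <= 1 - e]%R `\` [set x | F x <= 0]%R) <= mu D)%E.
  apply: le_measure; rewrite ?inE//.
    by apply: measurableD; exact: measurable_rcdf_le.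
  move=> x [/= Fx /negP]; rewrite -ltNge /cdf_domain/= => ->/=.
  by rewrite (le_lt_trans Fx)// ltrBlDr ltrDl.
have -> : mu ([set x | F x <= 1 - e]%R `\` [set x | F x <= 0]%R) = (1 - e)%:E.
  transitivity (mu [set x | F x <= 1 - e]%R - mu [set x | F x <= 0]%R)%E.
    rewrite measureD; try exact: measurable_rcdf_le; last first.
      by rewrite ltey_eq fin_num_measure//; exact: measurable_rcdf_le.
    by rewrite setIidr// => x /= /le_trans; apply; rewrite subr_ge0 ltW.
  by rewrite !rcdf_uniform ?lexx ?ler01 ?sube0//; apply/andP; split; lra.
by rewrite EFinB leeBlDr.
Qed.

(** Turns an event into one on which [cdf_reflect] follows the quantiles. *)
Lemma law_domainI A : measurable A -> mu (A `&` D) = mu A.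
Proof.
move=> mA; have mD := measurable_cdf_domain X.
rewrite -[in RHS](setUIDK A D) measureU0//.
- exact: measurableI.
- exact: measurableD.
apply: subset_measure0 law_cdf_domainC.
- exact: measurableD.
- exact: measurableC.
- exact: subIsetr.
Qed.

(** If V is uniform then so is 1 - V. Closed upper rays, which form a class
    stable under intersection, suffice to identify the two laws. *)
Lemma law_reflect A : measurable A -> mu (sigma @^-1` A) = mu A.
Proof.
have mD := measurable_cdf_domain X.
pose s : {mfun R >-> R} :=
  HB.pack (sigma : R -> R)
    (isMeasurableFun.Build _ _ _ _ _ measurable_cdf_reflect).
move=> mA; rewrite -[LHS]/(pushforward mu s A).
apply: (measure_unique (@RGenCInfty.G R) (fun n => `[- n%:R, +oo[%classic)) => //.
- exact: RGenCInfty.measurableE.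
- move=> _ _ [x ->] [y ->]; exists (Num.max x y).
  by apply/seteqP; split => z /=; rewrite !in_itv/= !andbT ge_max => /andP.
- by move=> n; exists (- n%:R).
- apply/seteqP; split => // x _; exists (Num.bound `|x|) => //=.
  rewrite in_itv/= andbT lerNl (le_trans (ler_norm _))// normrN.
  by rewrite ltW// archi_boundP.
- move=> _ [r ->]; rewrite -[LHS]/(mu (sigma @^-1` `[r, +oo[)).
  rewrite -[LHS]law_domainI; last first.
    by rewrite -[X in measurable X]setTI; exact: measurable_cdf_reflect.
  rewrite cdf_reflect_ray setIUl -setIA setIid setDE -setIA setICl setI0 setU0.
  rewrite law_domainI; last exact: measurable_rcdf_le.
  rewrite [RHS](law_ray mu_set1) rcdf_uniform//.
  by rewrite subr_ge0 rcdf_le1 lerBlDr lerDl rcdf_ge0.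
- move=> n; apply: (@le_lt_trans _ _ 1%E); last exact: ltry.
  by apply: (probability_le1 mu); exact: (measurable_funPTI s).
Qed.

Lemma integral_reflect A (h : R -> \bar R) : measurable A ->
  measurable_fun A h -> {in A, forall x, (0 <= h x)%E} ->
  (\int[mu]_(x in sigma @^-1` A) h (sigma x) = \int[mu]_(x in A) h x)%E.
Proof.
move=> mA mh h0; rewrite -(ge0_integral_pushforward measurable_cdf_reflect)//.
apply: eq_measure_integral; first exact: measurable_cdf_reflect.
by move=> ? B mB _; exact: law_reflect.
Qed.

End Reflection.

(** * Integration against a density *)

Section AbstractDensity.
Context {d : measure_display} {T : measurableType d} {R : realType}.

(** A density of nu with respect to m is m-almost everywhere the Radon-Nikodym
    derivative, for which the change of variables is known. *)
Lemma ge0_integral_density (nu : {finite_measure set T -> \bar R})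
    (m : {sigma_finite_measure set T -> \bar R}) (f : T -> R)
    (mf : measurable_fun setT f) (f0 : forall x, 0 <= f x)
    (nuE : forall A, measurable A -> nu A = (\int[m]_(x in A) (f x)%:E)%E)
    (A : set T) (h : T -> \bar R) :
  measurable A -> measurable_fun A h -> (forall x, 0 <= h x)%E ->
  (\int[nu]_(x in A) h x = \int[m]_(x in A) (h x * (f x)%:E))%E.
Proof.
move=> mA mh h0.
have nu_m : nu `<< m.
  apply/null_content_dominatesP => B mB B0.
  rewrite nuE//; apply: null_set_integral => //.
  by apply/measurable_EFinP/measurable_funTS.
have gi := Radon_Nikodym_SigmaFinite.f_integrable nu_m.
rewrite -(Radon_Nikodym_SigmaFinite.change_of_variables nu_m h0 mA mh).
set g := Radon_Nikodym_SigmaFinite.f _ _ in gi *.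
have mg : measurable_fun A g by apply: measurable_funTS; exact: measurable_int gi.
apply: ge0_ae_eq_integral => //.
- exact: emeasurable_funM.
- by apply: emeasurable_funM => //; apply/measurable_EFinP/measurable_funTS.
- move=> x _; apply: mule_ge0 => //.
  exact: (Radon_Nikodym_SigmaFinite.f_ge0 nu_m).
- by move=> x _; apply: mule_ge0; rewrite ?lee_fin.
apply: ae_eqe_mul2l; apply: integral_ae_eq => //.
- by apply: integrableS gi.
- by apply/measurable_EFinP/measurable_funTS.
- move=> B BA mB; rewrite -nuE//.
  by rewrite -(Radon_Nikodym_SigmaFinite.f_integral nu_m mB).
Qed.

End AbstractDensity.

Section Density.
Context {R : realType} {d : measure_display} {T : measurableType d}
  {P : probability T R} (X : {RV P >-> R}) (f : R -> R).
Local Notation lambda := (@lebesgue_measure R).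
Local Notation mu := (distribution P X).
Hypothesis f_pdf : is_pdf X f.

Let mf : measurable_fun setT f. Proof. by case: f_pdf. Qed.
Let f0 x : 0 <= f x. Proof. by case: f_pdf. Qed.
Let muE A : measurable A -> mu A = (\int[lambda]_(x in A) (f x)%:E)%E.
Proof. by case: f_pdf => _ _; exact. Qed.

Lemma law_set1 x : mu [set x] = 0%E.
Proof.
rewrite muE//; apply: null_set_integral => //.
  by apply/measurable_EFinP/measurable_funTS.
exact: lebesgue_measure_set1.
Qed.

Lemma measurable_density0 : measurable [set x | f x = 0].
Proof.
rewrite -[X in measurable X]setTI; exact: (mf measurableT (measurable_set1 0)).
Qed.

Lemma law_density0 : mu [set x | f x = 0] = 0%E.
Proof.
by rewrite muE ?integral0_eq//; [move=> x /= ->|exact: measurable_density0].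
Qed.

Lemma integral_law_density A (h : R -> \bar R) :
  measurable A -> measurable_fun A h -> (forall x, 0 <= h x)%E ->
  (\int[mu]_(x in A) h x = \int[lambda]_(x in A) (h x * (f x)%:E))%E.
Proof.
move=> mA mh h0.
(* The law lives on R with its Borel structure, Lebesgue measure on the type
   generated by half-open intervals: the sigma-algebras coincide but the bundled
   structures differ, so the law is rebuilt over the second one and integrals
   are carried across the identity. *)
pose nu : set (measurableTypeR R) -> \bar R := mu.
pose nuM := isMeasure.Build _ _ _ nu (measure0 mu) (@measure_ge0 _ _ _ mu)
  (@measure_semi_sigma_additive _ _ _ mu).
pose nuP := Measure_isProbability.Build _ _ _
  (HB.pack nu nuM : {measure set _ -> \bar R}) (probability_setT mu).
pose nu' : probability (measurableTypeR R) R := HB.pack nu nuM nuP.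
pose toR : measurableTypeR R -> R := idfun.
have mtoR : measurable_fun setT toR by move=> _ B mB; rewrite setTI.
have h0A : {in A, forall x, 0 <= h x}%E by [].
transitivity (\int[nu']_(x in A) h x)%E.
  rewrite -(ge0_integral_pushforward mtoR nu' mA mh h0A).
  by apply: eq_measure_integral.
exact: (@ge0_integral_density _ _ _ nu' lambda f mf f0 muE A h mA mh h0).
Qed.

Lemma measurable_inv_density : measurable_fun setT (fun x => (f x)^-1).
Proof.
rewrite (_ : (fun x => _) = (fun y => y `^ (-1)) \o f).
  by apply: measurableT_comp => //; exact: measurable_powR.
by apply/funext => x /=; rewrite powR_inv1.
Qed.

(** Lebesgue measure is recovered from the law where the density is positive:
    dx = (1/f) f dx. *)
Lemma integral_lebesgue_law A (h : R -> \bar R) : measurable A ->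
  {ae lambda, forall x, A x -> 0 < f x} ->
  measurable_fun A h -> (forall x, 0 <= h x)%E ->
  (\int[lambda]_(x in A) h x = \int[mu]_(x in A) (h x * (f x)^-1%:E))%E.
Proof.
move=> mA fA mh h0.
have mi : measurable_fun A (EFin \o (fun x => (f x)^-1)).
  by apply/measurable_EFinP/measurable_funTS; exact: measurable_inv_density.
rewrite integral_law_density//; last 2 first.
- exact: emeasurable_funM.
- by move=> x; apply: mule_ge0; rewrite ?lee_fin ?invr_ge0.
apply: ge0_ae_eq_integral => //.
- apply: emeasurable_funM; first exact: emeasurable_funM.
  by apply/measurable_EFinP/measurable_funTS.
- by move=> x _; rewrite !mule_ge0 ?lee_fin ?invr_ge0.
have [N [mN N0 sub]] := fA; exists N; split => // x /= hx.
apply: sub => /= fx; apply: hx => Ax; rewrite -muleA -EFinM mulVf ?mule1//.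
by rewrite gt_eqF// fx.
Qed.

End Density.

(** * The support *)

Section Support.
Context {R : realType} {d : measure_display} {T : measurableType d}
  {P : probability T R} (X : {RV P >-> R}).
Local Notation lambda := (@lebesgue_measure R).
Local Notation mu := (distribution P X).
Local Notation F := (rcdf X).
Local Notation D := (cdf_domain X).
Hypothesis Finj : cdf_invertible X.

Lemma cdf_domain_supp : D `<=` supp X.
Proof.
move=> x Dx e e0.
apply: (@lt_le_trans _ _ (mu `]x, x + e / 2])).
  rewrite law_itv ?lerDl ?divr_ge0 ?(ltW e0)// lte_fin subr_gt0.
  by rewrite ltNge (ler_rcdfr Finj)// -ltNge ltrDl divr_gt0.
apply: le_measure; rewrite ?inE//; first exact: measurable_ball.
move=> y /=; rewrite in_itv/= => /andP[xy yx].
rewrite /ball/= ltr_norml; apply/andP; split; lra.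
Qed.

(** Two distinct points of the support cannot both have F = 0, or both F = 1:
    one of them would have a neighbourhood inside a null ray. *)
Lemma supp_cdf_extreme x y : supp X x -> supp X y -> F x = F y -> ~ D x ->
  x = y.
Proof.
wlog xy : x y / x <= y.
  move=> wl sx sy Fxy Dx; have [xy|/ltW yx] := leP x y; first exact: wl.
  by apply/esym/wl => //; rewrite /cdf_domain/= -Fxy.
move=> sx sy Fxy Dx; apply/eqP; rewrite eq_le xy/= leNgt; apply/negP => ltxy.
have yx0 : 0 < y - x by rewrite subr_gt0.
have [F0|F0] := eqVneq (F x) 0.
  have := sx _ yx0; rewrite ltNge => /negP; apply.
  rewrite -[X in (_ <= X)%E]/(0%:E) -F0 Fxy rcdfE.
  apply: le_measure; rewrite ?inE//; first exact: measurable_ball.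
  by move=> z; rewrite /ball/= in_itv/= ltr_norml => /andP[]; lra.
have F1 : F x = 1.
  apply/eqP; rewrite eq_le rcdf_le1/= leNgt; apply/negP => F1; apply: Dx.
  by rewrite /cdf_domain/= lt_neqAle eq_sym F0 rcdf_ge0.
have := sy _ yx0; rewrite ltNge => /negP; apply.
have -> : 0%E = mu (~` `]-oo, x]).
  rewrite probability_setC// (_ : _ `]-oo, x]%classic = (F x)%:E).
    by rewrite F1 subee.
  by rewrite rcdfE.
apply: le_measure; rewrite ?inE//; first exact: measurable_ball.
  exact: measurableC.
move=> z; rewrite /ball/= in_itv/= ltr_norml => /andP[? ?].
by apply/negP; rewrite -ltNge; lra.
Qed.

Lemma countable_suppD : countable (supp X `\` D).
Proof.
pose S (c : R) := supp X `&` [set x | F x = c].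
(* The default value 0 of xget only serves when no such endpoint exists. *)
apply: (@sub_countable _ _ _ [set xget 0 (S 0); xget 0 (S 1)]); last first.
  by apply: finite_set_countable; exact: finite_set2.
apply: subset_card_le => x [sx Dx].
have sS : S (F x) x by [].
have xE : x = xget 0 (S (F x)).
  case: xgetP => [y _ [sy Fy]|/(_ x)//].
  exact: (supp_cdf_extreme sx sy (esym Fy) Dx).
have [F0|F0] := eqVneq (F x) 0; first by left; rewrite /= {1}xE F0.
right; rewrite /= {1}xE; congr (xget 0 (S _)).
apply/eqP; rewrite eq_le rcdf_le1/= leNgt; apply/negP => F1; apply: Dx.
by rewrite /cdf_domain/= lt_neqAle eq_sym F0 rcdf_ge0.
Qed.

Lemma measurable_supp : measurable (supp X).
Proof.
rewrite (_ : supp X = D `|` (supp X `\` D)).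
  apply: measurableU; first exact: measurable_cdf_domain.
  by apply: countable_measurable => //; exact: countable_suppD.
by rewrite setDUK//; exact: cdf_domain_supp.
Qed.

Lemma integral_supp (h : R -> \bar R) : measurable_fun setT h ->
  (forall x, 0 <= h x)%E ->
  (\int[lambda]_(x in supp X) h x = \int[lambda]_(x in D) h x)%E.
Proof.
move=> mh h0; have mD := measurable_cdf_domain X; have mS := measurable_supp.
rewrite (@ge0_negligible_integral _ _ _ lambda (supp X) (supp X `\` D))//.
- by rewrite setDD setIidr//; exact: cdf_domain_supp.
- exact: measurableD.
- exact: measurable_funTS.
- by apply: countable_lebesgue_measure0; exact: countable_suppD.
Qed.

End Support.

(** * Reflections of the line *)

Section LebesgueReflection.
Context {R : realType} (c : R).
Local Notation lambda := (@lebesgue_measure R).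

Let phi : measurableTypeR R -> measurableTypeR R := fun x => c - x.

Let measurable_phi : measurable_fun setT phi.
Proof. exact: measurable_funB. Qed.

Lemma lebesgue_measure_reflect (A : set R) : measurable A ->
  lambda (phi @^-1` A) = lambda A.
Proof.
move=> mA.
pose s : {mfun measurableTypeR R >-> measurableTypeR R} :=
  HB.pack phi (isMeasurableFun.Build _ _ _ _ _ measurable_phi).
rewrite -[LHS]/(pushforward lambda s A).
apply/esym/lebesgue_measure_unique => //= _ [[a b]] _ <-.
rewrite /pushforward (_ : _ @^-1` _ = `[c - b, c - a[%classic); last first.
  apply/seteqP; split => x /=; rewrite /phi !in_itv/= => /andP[? ?];
    by apply/andP; split; lra.
rewrite !lebesgue_measure_itv/= !lte_fin ltrD2l ltrN2.
by case: ifPn => // _; rewrite -!EFinB; congr EFin; lra.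
Qed.

Lemma ge0_integral_reflect (A : set R) (h : R -> \bar R) :
  measurable A -> measurable_fun A h -> (forall x, 0 <= h x)%E ->
  (\int[lambda]_(x in phi @^-1` A) h (c - x)%R = \int[lambda]_(x in A) h x)%E.
Proof.
move=> mA mh h0.
rewrite -(ge0_integral_pushforward measurable_phi)//.
apply: eq_measure_integral.
by move=> B mB _; exact: lebesgue_measure_reflect.
Qed.

End LebesgueReflection.

(** * Comparable functions with the same weighted integral *)

Section AEEquality.
Context {d : measure_display} {T : measurableType d} {R : realType}.
Variable mu : {measure set T -> \bar R}.

(** The excess of g2 over g1 has zero integral against the positive weight w;
    finiteness is what allows the common integral to be cancelled. *)
Lemma ae_eq_of_le_integral (A : set T) (w g1 g2 : T -> R) :
  measurable A -> measurable_fun setT w -> measurable_fun setT g1 ->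
  measurable_fun setT g2 -> (forall x, 0 <= w x) -> (forall x, A x -> 0 < w x) ->
  (forall x, 0 <= g1 x) -> (forall x, 0 <= g2 x) ->
  {ae mu, forall x, A x -> g1 x <= g2 x} ->
  (\int[mu]_(x in A) (w x * g1 x)%:E < +oo)%E ->
  (\int[mu]_(x in A) (w x * g1 x)%:E = \int[mu]_(x in A) (w x * g2 x)%:E)%E ->
  {ae mu, forall x, A x -> g1 x = g2 x}.
Proof.
move=> mA mw mg1 mg2 w0 wA g10 g20 g12 fin eq12.
(* The truncation makes the excess nonnegative everywhere, not just a.e. *)
pose k x := Num.max (g2 x - g1 x) 0.
have mk : measurable_fun setT k by apply: measurable_maxr => //; exact: measurable_funB.
have k0 x : 0 <= k x by rewrite le_max lexx orbT.
have mE (u : T -> R) : measurable_fun setT u -> measurable_fun A (EFin \o (w \* u)).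
  by move=> mu_u; apply/measurable_EFinP/measurable_funTS/measurable_funM.
have kint : (\int[mu]_(x in A) (w x * k x)%:E = 0)%E.
  have fn : (\int[mu]_(x in A) (w x * g1 x)%:E \is a fin_num)%E.
    by rewrite ge0_fin_numE// integral_ge0// => x _; rewrite lee_fin mulr_ge0.
  rewrite -[LHS](addeK _ fn) -[in RHS](subee fn); congr (_ - _)%E.
  rewrite [RHS]eq12 addeC -ge0_integralD//.
  - apply: ge0_ae_eq_integral => //.
    + by apply: emeasurable_funD; exact: mE.
    + exact: mE.
    + by move=> x _; rewrite adde_ge0// lee_fin mulr_ge0.
    + by move=> x _; rewrite lee_fin mulr_ge0.
    + apply: filterS g12 => x g12 Ax; rewrite -EFinD -mulrDr; congr (_ * _)%:E.
      by rewrite /k max_l ?subr_ge0 ?g12// addrC subrK.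
  - by move=> x _; rewrite lee_fin mulr_ge0.
  - exact: mE.
  - by move=> x _; rewrite lee_fin mulr_ge0.
  - exact: mE.
have : ae_eq mu A (EFin \o (w \* k)) (cst 0%E).
  apply/ae_eq_integral_abs => //; first exact: mE.
  rewrite -[RHS]kint; apply: eq_integral => x _ /=.
  by rewrite ger0_norm// mulr_ge0.
apply: filterS2 g12 => x g12 wk Ax.
apply/eqP; rewrite eq_le g12//=; have := wk Ax; case => /eqP.
by rewrite mulf_eq0 gt_eqF ?wA//= => /eqP kx0; rewrite -subr_le0 -kx0 /k le_max lexx.
Qed.

End AEEquality.

(** * From equal extropies to symmetry *)

Section EqualExtropies.
Context {R : realType} {d : measure_display} {T : measurableType d}
  {P : probability T R} (X : {RV P >-> R}) (f : R -> R).
Local Notation lambda := (@lebesgue_measure R).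
Local Notation mu := (distribution P X).
Local Notation F := (rcdf X).
Local Notation D := (cdf_domain X).
Local Notation sigma := (cdf_reflect X).
Hypothesis f_pdf : is_pdf X f.
Hypothesis Finj : cdf_invertible X.
Hypothesis f_gt0 : {ae lambda, forall x, supp X x -> 0 < f x}.

Let mu_set1 := law_set1 f_pdf.
Definition cdf_median := cdf_inv X 2^-1.
Definition inv_density x := (f x)^-1.
Definition lower_half := [set x | 0 < F x < 2^-1].
Definition upper_half := [set x | 2^-1 < F x < 1].
(** Up to sign, the difference between (1 - F)^2 and F^2; it is invariant under
    the reflection. *)
Definition tail_weight x := `|1 - 2 * F x|.
Local Notation m := cdf_median.
Local Notation g := inv_density.
Local Notation L := lower_half.
Local Notation U := upper_half.
Local Notation w := tail_weight.

Let f0 x : 0 <= f x. Proof. by case: f_pdf. Qed.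
Let g0 x : 0 <= g x. Proof. by rewrite invr_ge0. Qed.
Let mg : measurable_fun setT g. Proof. exact: measurable_inv_density f_pdf. Qed.
Let mF := measurable_rcdf X.
Let ms := measurable_cdf_reflect mu_set1 Finj.
Let mw : measurable_fun setT w.
Proof.
apply: measurableT_comp => //.
by apply: measurable_funB => //; exact: measurable_funM.
Qed.

Lemma rcdf_median : F m = 2^-1.
Proof. by rewrite cdf_invK//; apply/andP; split; lra. Qed.

Lemma domain_median : D m.
Proof. by rewrite /cdf_domain/= rcdf_median; apply/andP; split; lra. Qed.

Lemma reflect_median : sigma m = m.
Proof.
have Dm := domain_median.
apply: Finj; rewrite ?inE//; first by apply/(cdf_domain_reflect mu_set1).
by rewrite (rcdf_reflect mu_set1)// rcdf_median; lra.
Qed.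

Lemma measurable_lower_half : measurable L.
Proof.
rewrite (_ : L = F @^-1` `]0, 2^-1[)%classic.
  by rewrite -[X in measurable X]setTI; exact: mF.
by apply/seteqP; split => x; rewrite /L/= in_itv.
Qed.

Lemma measurable_upper_half : measurable U.
Proof.
rewrite (_ : U = F @^-1` `]2^-1, 1[)%classic.
  by rewrite -[X in measurable X]setTI; exact: mF.
by apply/seteqP; split => x; rewrite /U/= in_itv.
Qed.
Let mL := measurable_lower_half.
Let mU := measurable_upper_half.

Lemma lower_half_domain : L `<=` D.
Proof. by move=> x /=; rewrite /L /cdf_domain/=; lra. Qed.

Lemma upper_half_domain : U `<=` D.
Proof. by move=> x /=; rewrite /U /cdf_domain/=; lra. Qed.

Lemma preimage_reflect_upper : sigma @^-1` U = L.
Proof.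
apply/seteqP; split => x.
- move=> Ux; have Dx : D x by apply/(cdf_domain_reflect mu_set1)/upper_half_domain.
  by move: Ux; rewrite /U /L/= (rcdf_reflect mu_set1)//; lra.
- move=> Lx; have Dx := lower_half_domain Lx.
  by move: Lx; rewrite /U /L/= (rcdf_reflect mu_set1)//; lra.
Qed.

Lemma preimage_reflectK A : sigma @^-1` (sigma @^-1` A) = A.
Proof. by apply/seteqP; split => x /=; rewrite (cdf_reflectK mu_set1 Finj). Qed.

Lemma density_gt0_on A : A `<=` D -> {ae lambda, forall x, A x -> 0 < f x}.
Proof.
move=> AD; have [N [mN N0 sub]] := f_gt0; exists N; split => // x /= fx.
by apply: sub => /= h; apply: fx => /AD Dx; apply: h; exact: cdf_domain_supp.
Qed.

(** The image of Lebesgue measure by the reflection has density g o sigma with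
    respect to the law, because the law itself is invariant. *)
Lemma integral_lebesgue_reflect A (h : R -> R) : measurable A -> A `<=` D ->
  measurable_fun setT h -> (forall x, 0 <= h x) ->
  (\int[lambda]_(x in A) (h x)%:E =
   \int[mu]_(x in sigma @^-1` A) (h (sigma x) * g (sigma x))%:E)%E.
Proof.
move=> mA AD mh h0.
rewrite (integral_lebesgue_law f_pdf mA (density_gt0_on AD))//; last first.
  exact/measurable_EFinP/measurable_funTS.
symmetry.
apply: (integral_reflect mu_set1 Finj (h := fun x => (h x * g x)%:E)) => //.
- by apply/measurable_EFinP/measurable_funTS/measurable_funM.
- by move=> x _; rewrite lee_fin mulr_ge0.
Qed.

(** The median itself is the only point left out, and it is a null set. *)
Lemma integral_domain (h : R -> \bar R) : measurable_fun setT h ->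
  (forall x, 0 <= h x)%E ->
  (\int[lambda]_(x in D) h x =
   \int[lambda]_(x in L) h x + \int[lambda]_(x in U) h x)%E.
Proof.
move=> mh h0; have mD := measurable_cdf_domain X.
rewrite (@ge0_negligible_integral _ _ _ lambda D [set m])//; last 2 first.
- exact: measurable_funTS.
- exact: lebesgue_measure_set1.
rewrite (_ : D `\` _ = L `|` U).
  rewrite ge0_integral_setU//; first exact: measurable_funTS.
  by apply/disj_set2P; apply/seteqP; split => // x []; rewrite /L /U/=; lra.
apply/seteqP; split => x; rewrite /cdf_domain/=.
  move=> [Dx xm]; have := Dx; have : F x != 2^-1.
    apply/eqP; rewrite -rcdf_median => Fxm; apply: xm.
    by apply: Finj; rewrite ?inE//; exact: domain_median.
  by rewrite neq_lt => /orP[Fx|Fx] /andP[F0 F1]; [left|right]; apply/andP.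
move=> LUx; split.
  by case: LUx => [/lower_half_domain|/upper_half_domain].
by move=> xm; case: LUx; rewrite /L /U/= xm rcdf_median; lra.
Qed.

(** The contributions of F^2 and (1 - F)^2 differ by the tail weight, in favour of
    (1 - F)^2 below the median and of F^2 above it; finite equal totals force
    these two differences to agree. *)
Lemma tail_weight_balance :
  (\int[lambda]_(x in D) ((F x) ^+ 2)%:E < +oo)%E ->
  (\int[lambda]_(x in D) ((F x) ^+ 2)%:E =
   \int[lambda]_(x in D) ((1 - F x) ^+ 2)%:E)%E ->
  (\int[lambda]_(x in L) (w x)%:E < +oo)%E /\
  (\int[lambda]_(x in L) (w x)%:E = \int[lambda]_(x in U) (w x)%:E)%E.
Proof.
have mF2 : measurable_fun setT (fun x => ((F x) ^+ 2)%:E).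
  by apply/measurable_EFinP; exact: measurable_funX.
have mG2 : measurable_fun setT (fun x => ((1 - F x) ^+ 2)%:E).
  by apply/measurable_EFinP; apply: measurable_funX; exact: measurable_funB.
have mwE : measurable_fun setT (fun x => (w x)%:E) by exact/measurable_EFinP.
have F20 x : (0 <= ((F x) ^+ 2)%:E)%E by rewrite lee_fin sqr_ge0.
have G20 x : (0 <= ((1 - F x) ^+ 2)%:E)%E by rewrite lee_fin sqr_ge0.
have w0 x : (0 <= (w x)%:E)%E by rewrite lee_fin normr_ge0.
rewrite !integral_domain//.
have -> : (\int[lambda]_(x in L) ((1 - F x) ^+ 2)%:E =
    \int[lambda]_(x in L) ((F x) ^+ 2)%:E + \int[lambda]_(x in L) (w x)%:E)%E.
  rewrite -ge0_integralD//; try exact: measurable_funTS.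
  apply: eq_integral => x; rewrite inE => Lx; rewrite -EFinD; congr EFin.
  by rewrite /w ger0_norm; [ring|move: Lx; rewrite /L/=; lra].
have -> : (\int[lambda]_(x in U) ((F x) ^+ 2)%:E =
    \int[lambda]_(x in U) ((1 - F x) ^+ 2)%:E +
    \int[lambda]_(x in U) (w x)%:E)%E.
  rewrite -ge0_integralD//; try exact: measurable_funTS.
  apply: eq_integral => x; rewrite inE => Ux; rewrite -EFinD; congr EFin.
  by rewrite /w ler0_norm; [ring|move: Ux; rewrite /U/=; lra].
(* Four nonnegative extended reals with a + (s + u) = (a + l) + s < +oo. *)
have : (0 <= \int[lambda]_(x in L) ((F x) ^+ 2)%:E)%E by exact: integral_ge0.
have : (0 <= \int[lambda]_(x in U) ((1 - F x) ^+ 2)%:E)%E by exact: integral_ge0.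
have : (0 <= \int[lambda]_(x in L) (w x)%:E)%E by exact: integral_ge0.
have : (0 <= \int[lambda]_(x in U) (w x)%:E)%E by exact: integral_ge0.
case: (integral _ _ _) => [u| |]//; case: (integral _ _ _) => [l| |]//;
case: (integral _ _ _) => [s| |]//; case: (integral _ _ _) => [a| |]//=.
move=> _ _ _ _ _ [e]; split; first exact: ltry.
by congr EFin; lra.
Qed.

Let mgs : measurable_fun setT (g \o sigma).
Proof. exact: measurableT_comp. Qed.

(** The class condition at u = F x compares f at x and at its reflection. Passing
    to reciprocals needs the smaller of the two densities to be positive, which
    fails only on a null set of the law, by invariance in the second case. *)
Lemma class_inv_density : classC X f ->
  {ae mu, forall x, L x -> g (sigma x) <= g x} \/
  {ae mu, forall x, L x -> g x <= g (sigma x)}.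
Proof.
have LE x : L x -> [/\ 0 < F x < 2^-1, cdf_inv X (F x) = x &
    cdf_inv X (1 - F x) = sigma x].
  move=> Lx; have Dx := lower_half_domain Lx; split => //.
    by rewrite (rcdfK Finj)// inE.
  by rewrite /cdf_reflect ifT.
have fN0 : mu.-negligible [set x | f x = 0].
  exists [set x | f x = 0]; split => //; last exact: law_density0 f_pdf.
  exact: measurable_density0 f_pdf.
move=> [_ [cls|cls]]; [left|right].
- apply: negligibleS fN0 => x /= ngx.
  apply: contrapT => /eqP fx; apply: ngx => /LE[Fx QF Qs].
  have := cls _ Fx; rewrite QF Qs => ffs.
  have fx0 : 0 < f x by rewrite lt_neqAle eq_sym fx f0.
  by rewrite /g lef_pV2// posrE// (lt_le_trans fx0).
- have fsN0 : mu.-negligible (sigma @^-1` [set x | f x = 0]).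
    have mf0 := measurable_density0 f_pdf.
    exists (sigma @^-1` [set x | f x = 0]); split => //.
      by rewrite -[X in measurable X]setTI; exact: ms.
    by rewrite (law_reflect mu_set1 Finj)//; exact: law_density0 f_pdf.
  apply: negligibleS fsN0 => x /= ngx.
  apply: contrapT => /eqP fx; apply: ngx => /LE[Fx QF Qs].
  have := cls _ Fx; rewrite QF Qs => ffs.
  have fx0 : 0 < f (sigma x) by rewrite lt_neqAle eq_sym fx f0.
  by rewrite /g lef_pV2// posrE// (lt_le_trans fx0).
Qed.

Lemma inv_density_reflect : classC X f ->
  (\int[lambda]_(x in D) ((F x) ^+ 2)%:E < +oo)%E ->
  (\int[lambda]_(x in D) ((F x) ^+ 2)%:E =
   \int[lambda]_(x in D) ((1 - F x) ^+ 2)%:E)%E ->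
  {ae mu, forall x, L x -> g (sigma x) = g x}.
Proof.
move=> cls fin eqJ; have [finw eqw] := tail_weight_balance fin eqJ.
have w0 x : 0 <= w x by rewrite /w.
have wL x : L x -> 0 < w x.
  by move=> Lx; rewrite /w normr_gt0; apply/eqP; move: Lx; rewrite /L/=; lra.
have EL : (\int[lambda]_(x in L) (w x)%:E = \int[mu]_(x in L) (w x * g x)%:E)%E.
  apply: (integral_lebesgue_law f_pdf mL (density_gt0_on lower_half_domain)).
    exact/measurable_EFinP/measurable_funTS.
  by move=> x; rewrite lee_fin.
have EU : (\int[lambda]_(x in U) (w x)%:E =
    \int[mu]_(x in L) (w x * (g \o sigma) x)%:E)%E.
  rewrite (integral_lebesgue_reflect mU upper_half_domain mw w0).
  rewrite preimage_reflect_upper.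
  apply: eq_integral => x; rewrite inE => Lx; congr (_ * _)%:E.
  rewrite /w (rcdf_reflect mu_set1)//; last exact: lower_half_domain.
  by rewrite -normrN; congr (`|_|); ring.
have gs0 x : 0 <= (g \o sigma) x by exact: g0.
case: (class_inv_density cls) => gle.
- apply: (@ae_eq_of_le_integral _ _ _ mu L w (g \o sigma) g) => //.
  + by rewrite -EU -eqw.
  + by rewrite -EU -EL.
- have := @ae_eq_of_le_integral _ _ _ mu L w g (g \o sigma)
    mL mw mg mgs w0 wL g0 gs0 gle.
  rewrite -EU -EL => /(_ finw eqw); apply: filterS => x h Lx.
  by rewrite h.
Qed.

(** The reflection maps the interval from x to m onto the one from m to sigma x;
    the equality of densities makes their lengths equal. *)
Lemma reflect_lower : {ae mu, forall x, L x -> g (sigma x) = g x} ->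
  forall x, L x -> sigma x = m - (x - m).
Proof.
move=> gE x Lx.
have Dx := lower_half_domain Lx; have Dm := domain_median.
have Dsx : D (sigma x) by apply/(cdf_domain_reflect mu_set1).
have xmL : `]x, m[%classic `<=` L.
  move=> y; rewrite /= in_itv/= => /andP[xy ym].
  move: Lx; rewrite /L/= => /andP[Fx _]; apply/andP; split.
    by rewrite (lt_le_trans Fx)// le_rcdf// ltW.
  by rewrite -rcdf_median ltNge (ler_rcdfl Finj)// -ltNge.
have pre : sigma @^-1` `]x, m[ = `]m, sigma x[%classic.
  apply/seteqP; split => y /=.
    move=> ysm; have Dy : D y.
      by apply/(cdf_domain_reflect mu_set1)/lower_half_domain/xmL.
    move: ysm; rewrite !in_itv/= -{1}(cdf_reflectK mu_set1 Finj x).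
    rewrite -{1}reflect_median.
    by rewrite !(ltr_cdf_reflect mu_set1 Finj)// andbC.
  rewrite !in_itv/= => mys; have /andP[my ys] := mys.
  have Dy : D y.
    move: Dm Dsx; rewrite /cdf_domain/= => /andP[Fm _] /andP[_ Fs].
    by rewrite (lt_le_trans Fm) ?(le_lt_trans _ Fs)// le_rcdf// ltW.
  rewrite -{1}(cdf_reflectK mu_set1 Finj x) -{1}reflect_median.
  by rewrite !(ltr_cdf_reflect mu_set1 Finj)// andbC.
have mA : measurable `]x, m[%classic by [].
have AD : `]x, m[%classic `<=` D by exact: subset_trans lower_half_domain.
have m1 : measurable_fun (setT : set R) (fun=> 1 : R) by [].
have lam : lambda `]x, m[ = lambda `]m, sigma x[.
  have cst1 (A : set R) : measurable A -> lambda A = (\int[lambda]_(x in A) 1%:E)%E.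
    by move=> mA'; rewrite integral_cst// mul1e.
  have mA' : measurable (sigma @^-1` `]x, m[).
    by rewrite -[X in measurable X]setTI; exact: ms.
  rewrite -pre !cst1//.
  rewrite (integral_lebesgue_law f_pdf mA (density_gt0_on AD))//.
  rewrite (integral_lebesgue_reflect mA' _ m1)//; last first.
    by move=> y /AD; rewrite /= => /(cdf_domain_reflect mu_set1).
  rewrite preimage_reflectK; apply: ge0_ae_eq_integral => //.
  - apply: emeasurable_funM; first exact: measurable_cst.
    apply/measurable_EFinP/measurable_funTS; exact: mg.
  - by apply/measurable_EFinP/measurable_funTS/measurable_funM => //; exact: mgs.
  - by move=> y _; rewrite mul1e lee_fin g0.
  - by move=> y _; rewrite mul1r lee_fin g0.
  - by apply: filterS gE => y gy /xmL Ly; rewrite mul1e mul1r gy.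
have xm : x < m.
  by rewrite ltNge -(ler_rcdfl Finj)// rcdf_median -ltNge; case/andP: Lx.
have msx : m < sigma x.
  by rewrite -{1}reflect_median (ltr_cdf_reflect mu_set1 Finj).
move: lam; rewrite !lebesgue_measure_itv/= !lte_fin xm msx => -[]; lra.
Qed.

Lemma reflect_domain : {ae mu, forall x, L x -> g (sigma x) = g x} ->
  forall x, D x -> sigma x = m - (x - m).
Proof.
move=> gE x Dx; have := @reflect_lower gE; have Dm := domain_median.
have [Fx|Fx|Fx] := ltgtP (F x) 2^-1 => rl.
- by apply: rl; case/andP: Dx => Fx0 _; apply/andP.
- have Lsx : L (sigma x).
    rewrite /L/= (rcdf_reflect mu_set1)//.
    by move: Dx Fx; rewrite /cdf_domain/=; lra.
  by have := rl _ Lsx; rewrite (cdf_reflectK mu_set1 Finj); lra.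
- have -> : x = m by apply: Finj; rewrite ?inE// rcdf_median.
  by rewrite reflect_median; lra.
Qed.

(** For points m - t and m + t outside the domain, F is 0 on the left and 1 on
    the right, by comparison with its value 1/2 at m. *)
Lemma symmetric_of_reflect :
  (forall x, D x -> sigma x = m - (x - m)) -> symmetric_distribution X.
Proof.
move=> sE; exists m => t.
wlog t0 : t / 0 <= t.
  move=> wl; have [/wl//|/ltW t0] := leP 0 t.
  by have := wl (- t); rewrite opprK oppr_ge0 addrC => ->.
have [Dx|Dx] := pselect (D (m - t)).
  have := sE _ Dx; rewrite (_ : m - (m - t - m) = m + t); last by lra.
  by move=> <-; rewrite (rcdf_reflect mu_set1)//; lra.
have [Dy|Dy] := pselect (D (m + t)).
  have := sE _ Dy; rewrite (_ : m - (m + t - m) = m - t); last by lra.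
  by move=> <-; rewrite (rcdf_reflect mu_set1)//; lra.
have Fl : F (m - t) <= 2^-1 by rewrite -rcdf_median le_rcdf// gerBl.
have Fu : 2^-1 <= F (m + t) by rewrite -rcdf_median le_rcdf// lerDl.
have -> : F (m - t) = 0.
  apply/eqP; rewrite eq_le rcdf_ge0 andbT leNgt; apply/negP => F0; apply: Dx.
  by rewrite /cdf_domain/= F0/=; lra.
rewrite add0r; apply/eqP; rewrite eq_le rcdf_le1/= leNgt; apply/negP => F1.
by apply: Dy; rewrite /cdf_domain/= F1 andbT; lra.
Qed.

End EqualExtropies.

(** * From symmetry to equal extropies *)

Section SymmetricLaw.
Context {R : realType} {d : measure_display} {T : measurableType d}
  {P : probability T R} (X : {RV P >-> R}).
Local Notation lambda := (@lebesgue_measure R).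
Local Notation F := (rcdf X).
Local Notation D := (cdf_domain X).

Lemma symmetric_integral : symmetric_distribution X ->
  (\int[lambda]_(x in D) ((F x) ^+ 2)%:E =
   \int[lambda]_(x in D) ((1 - F x) ^+ 2)%:E)%E.
Proof.
move=> [c Fc]; have FE x : F (c + c - x) = 1 - F x.
  have := Fc (x - c); have -> : c - (x - c) = c + c - x by lra.
  by rewrite (_ : c + (x - c) = x); lra.
have mF2 : measurable_fun setT (fun x => ((F x) ^+ 2)%:E).
  by apply/measurable_EFinP; apply: measurable_funX; exact: measurable_rcdf.
have mD := measurable_cdf_domain X.
rewrite -(ge0_integral_reflect (c + c) (h := fun x => ((F x) ^+ 2)%:E) mD)//;
  last 2 first.
- exact: measurable_funTS.
- by move=> x; rewrite lee_fin sqr_ge0.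
rewrite (_ : _ @^-1` D = D); last first.
  by apply/seteqP; split => x /=; rewrite /cdf_domain/= FE itv01_onem.
by apply: eq_integral => x _; rewrite FE.
Qed.

End SymmetricLaw.

(** * The equivalence *)

Unset Implicit Arguments.
Set Strict Implicit.

Theorem theorem2p1 (R : realType) (d : measure_display) (T : measurableType d)
    (P : probability T R) (X : {RV P >-> R}) (f : R -> R)
    (f_pdf : is_pdf X f)
    (F_invertible : cdf_invertible X)
    (f_gt0 : {ae lebesgue_measure, forall x : R, supp X x -> 0 < f x})
    (X_classC : classC X f) :
  (symmetric_distribution X ->
     cumulative_past_extropy X = cumulative_residual_extropy X) /\
  (cumulative_past_extropy X \is a fin_num \/
     cumulative_residual_extropy X \is a fin_num ->
   cumulative_past_extropy X = cumulative_residual_extropy X ->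
     symmetric_distribution X).
Proof.
have mF := measurable_rcdf X.
have supp_domain (h : R -> R) : measurable_fun setT h ->
    (\int[lebesgue_measure]_(x in supp X) ((h x) ^+ 2)%:E =
     \int[lebesgue_measure]_(x in cdf_domain X) ((h x) ^+ 2)%:E)%E.
  move=> mh; apply: (integral_supp F_invertible).
    by apply/measurable_EFinP; exact: measurable_funX.
  by move=> x; rewrite lee_fin sqr_ge0.
rewrite /cumulative_past_extropy /cumulative_residual_extropy.
rewrite !supp_domain//; last exact: measurable_funB.
split=> [symX|fin eqJ]; first by rewrite (symmetric_integral symX).
set I := (\int[lebesgue_measure]_(x in cdf_domain X)
  ((rcdf X x) ^+ 2)%:E)%E in fin eqJ.
have finJ : (- (2^-1)%:E * I)%E \is a fin_num.
  by case: fin => //; rewrite eqJ.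
have finI : (I < +oo)%E.
  rewrite ltey; apply/eqP => Ioo; move: finJ.
  by rewrite Ioo -EFinN lt0_muley// lte_fin oppr_lt0 invr_gt0.
have eqI : I = (\int[lebesgue_measure]_(x in cdf_domain X)
    ((1 - rcdf X x) ^+ 2)%:E)%E.
  have := congr1 (mule (- 2)%:E) eqJ; rewrite !muleA -EFinN -EFinM.
  by rewrite mulrNN divff ?mul1e.
apply: (symmetric_of_reflect f_pdf).
apply: (reflect_domain f_pdf F_invertible f_gt0).
exact: (inv_density_reflect f_pdf F_invertible f_gt0).
Qed.
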